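(* Let $R$ be a unital ring with involution and let $a\in R$ be Moore-Penrose invertible with Moore-Penrose inverse $a^\dagger$. Then the following are equivalent: (1) $a$ is an EP element; (2) $[a^\dagger a,a]=[a^\dagger,aa^\dagger]=0$; (3) $[a^\dagger a,a]=[a,aa^\dagger]=0$; (4) $[a^\dagger a,a^\dagger]=[a^\dagger,aa^\dagger]=0$; (5) $[a^\dagger a,a^\dagger]=[a,aa^\dagger]=0$.
   Context: A unital (associative, not necessarily commutative) ring with involution is a unital ring $R$ with a map $a\mapsto a^*$ satisfying $(a^* )^*=a$, $(ab)^*=b^*a^*$, $(a+b)^*=a^*+b^*$ for all $a,b\in R$. Notation: $[a,b]=ab-ba$. The Moore-Penrose inverse of $a\in R$ is the element $a^\dagger=x$ (unique if it exists) with $axa=a$, $xax=x$, $(ax)^*=ax$, $(xa)^*=xa$; the group inverse of $a$ is the element $a^\#=x$ (unique if it exists) with $axa=a$, $xax=x$, $ax=xa$. An element $a\in R$ is EP if it is both Moore-Penrose invertible and group invertible and $a^\dagger=a^\#$. *)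

(* Defs.v *)
From mathcomp Require Import all_boot all_algebra.

Set Implicit Arguments.
Unset Strict Implicit.
Unset Printing Implicit Defensive.

Import GRing.Theory.
Local Open Scope ring_scope.

(* pzRingType: unital associative rings, with the zero ring allowed. *)
Definition ring_involution (R : pzRingType) (star : R -> R) : Prop :=
  [/\ forall a : R, star (star a) = a,
      forall a b : R, star (a * b) = star b * star a
    & forall a b : R, star (a + b) = star a + star b].

Definition commutator (R : pzRingType) (a b : R) : R := a * b - b * a.

(* Both inverses are given as relations "x is an inverse of a"; in each case
   such an x is unique when it exists. *)
Definition moore_penrose_inverse (R : pzRingType) (star : R -> R) (a x : R) :
    Prop :=
  [/\ a * x * a = a,
      x * a * x = x,
      star (a * x) = a * x
    & star (x * a) = x * a].

Definition group_inverse (R : pzRingType) (a x : R) : Prop :=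
  [/\ a * x * a = a, x * a * x = x & a * x = x * a].

Definition EP (R : pzRingType) (star : R -> R) (a : R) : Prop :=
  exists x y : R,
    [/\ moore_penrose_inverse star a x, group_inverse a y & x = y].

(* Main.v *)
Require Import Defs.
From Corelib Require Import Setoid.
From mathcomp Require Import all_boot all_algebra.

Import GRing.Theory.
Local Open Scope ring_scope.

(** Write x for the Moore-Penrose inverse of a, and consider the two projections
    (self-adjoint idempotents) p = x a and q = a x.  All five conditions say
    that p = q.

    For the EP property this is the uniqueness of the Moore-Penrose inverse
    ([EP_projections_eq]).  As for the commutators, a p = a and p x = x always
    hold, so [p, a] = 0 says p a = a and [p, x] = 0 says x p = x.  The first
    amounts to p q = q and the second to q p = q, and the involution exchanges
    these two equations: both say that q lies below p.  Since the roles of a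
    and x can be exchanged, which swaps p and q, the conditions [x, q] = 0 and
    [a, q] = 0 both say that p lies below q.  Each of the four commutator conditions
    pairs one commutator of the first kind with one of the second, so each of
    them forces p = q by antisymmetry. *)

Section MoorePenrose.

Set Implicit Arguments.
Unset Strict Implicit.

Variables (R : pzRingType) (star : R -> R).
Hypothesis star_inv : ring_involution star.

Lemma commutator_eq0 (u v : R) : commutator u v = 0 <-> u * v = v * u.
Proof. by split=> [/subr0_eq | eq_uv]; rewrite // /commutator eq_uv subrr. Qed.

Lemma commutator0C (u v : R) : commutator u v = 0 <-> commutator v u = 0.
Proof. by rewrite !commutator_eq0; split. Qed.

Lemma moore_penrose_inverse_sym (a x : R) :
  moore_penrose_inverse star a x -> moore_penrose_inverse star x a.
Proof. by case. Qed.

(** Applying the involution to e f = f reverses the product; this is why the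
    order on projections has a left and a right form. *)
Lemma projection_le_sym (e f : R) :
  star e = e -> star f = f -> e * f = f <-> f * e = f.
Proof.
case: star_inv => _ starM _ se sf.
by split=> /(congr1 star); rewrite starM se sf.
Qed.

Lemma projection_le_anti (e f : R) :
  star e = e -> star f = f -> e * f = f -> f * e = e -> e = f.
Proof.
by move=> se sf /(projection_le_sym se sf) fe_f fe_e; rewrite -[LHS]fe_e.
Qed.

(** Both products a x and a y project onto the right ideal a R, and a
    projection is determined by its range. *)
Lemma range_projection_unique (a x y : R) :
  moore_penrose_inverse star a x -> moore_penrose_inverse star a y ->
  a * x = a * y.
Proof.
case=> axa _ sax _ [aya _ say _].
by apply: projection_le_anti => //; rewrite mulrA ?axa ?aya.
Qed.

(** This is [range_projection_unique] in the opposite ring. *)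
Lemma corange_projection_unique (a x y : R) :
  moore_penrose_inverse star a x -> moore_penrose_inverse star a y ->
  x * a = y * a.
Proof.
case=> axa _ _ sxa [aya _ _ sya].
apply: projection_le_anti => //; apply/projection_le_sym => //.
  by rewrite -mulrA [a * _]mulrA axa.
by rewrite -mulrA [a * _]mulrA aya.
Qed.

Lemma moore_penrose_inverse_unique (a x y : R) :
  moore_penrose_inverse star a x -> moore_penrose_inverse star a y -> x = y.
Proof.
move=> ax_mp ay_mp; case: (ax_mp) (ay_mp) => _ xax _ _ [_ yay _ _].
rewrite -xax (corange_projection_unique ax_mp ay_mp) -mulrA.
by rewrite (range_projection_unique ax_mp ay_mp) mulrA.
Qed.

Lemma EP_projections_eq (a x : R) :
  moore_penrose_inverse star a x -> EP star a <-> x * a = a * x.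
Proof.
move=> ax_mp; split=> [[y [z [ay_mp [_ _ az_comm] eq_yz]]] | eq_pq].
  by rewrite (moore_penrose_inverse_unique ax_mp ay_mp) eq_yz.
by exists x, x; case: (ax_mp).
Qed.

(** As a p = a, the commutator vanishes iff p a = a; multiplication on the right
    by x turns this into p q = q, and multiplication by a turns it back. *)
Lemma commutator_corange_self (a x : R) :
  moore_penrose_inverse star a x ->
  commutator (x * a) a = 0 <-> (x * a) * (a * x) = a * x.
Proof.
case=> axa _ _ _; rewrite commutator_eq0 [a * (x * a)]mulrA axa mulrA.
have u_axa u : u * a * x * a = u * a by rewrite -2!mulrA [a * _]mulrA axa.
by split=> [-> // | /(congr1 (fun u => u * a))]; rewrite u_axa axa.
Qed.

(** As p x = x, the commutator vanishes iff x p = x; multiplication on the left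
    by a turns this into q p = q, which is the adjoint of p q = q. *)
Lemma commutator_corange_inverse (a x : R) :
  moore_penrose_inverse star a x ->
  commutator (x * a) x = 0 <-> (x * a) * (a * x) = a * x.
Proof.
case=> _ xax sq sp; rewrite commutator_eq0 xax projection_le_sym //.
split=> [x_xp | /(congr1 (fun u => x * u))]; first by rewrite -mulrA -x_xp.
by rewrite !mulrA xax => ->.
Qed.

Lemma projections_eq_le (a x : R) :
  moore_penrose_inverse star a x ->
  x * a = a * x <->
  (x * a) * (a * x) = a * x /\ (a * x) * (x * a) = x * a.
Proof.
case=> axa _ sq sp; split=> [-> | [q_le_p p_le_q]].
  by rewrite mulrA axa.
exact: projection_le_anti.
Qed.

End MoorePenrose.

Theorem proposition4p7 (R : pzRingType) (star : R -> R)
    (star_inv : ring_involution star) (a adag : R)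
    (a_mp : moore_penrose_inverse star a adag) :
  [<-> EP star a;
       commutator (adag * a) a = 0 /\ commutator adag (a * adag) = 0;
       commutator (adag * a) a = 0 /\ commutator a (a * adag) = 0;
       commutator (adag * a) adag = 0 /\ commutator adag (a * adag) = 0;
       commutator (adag * a) adag = 0 /\ commutator a (a * adag) = 0].
Proof.
have adag_mp := moore_penrose_inverse_sym a_mp.
have EP_le := iff_trans (EP_projections_eq star_inv a_mp)
                        (projections_eq_le star_inv a_mp).
have pa := commutator_corange_self a_mp.
have px := commutator_corange_inverse star_inv a_mp.
have xq := iff_trans (commutator0C adag _) (commutator_corange_self adag_mp).
have aq := iff_trans (commutator0C a _)
                     (commutator_corange_inverse star_inv adag_mp).
by tfae; rewrite ?EP_le ?pa ?px ?xq ?aq.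
Qed.
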